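(* Let $n\ge 1$ and let $G$ be a graph on $n$ vertices that maximizes $\partial(G)+\partial(\bar{G})$ among all graphs on $n$ vertices. Then $\min\{\delta(G),\delta(\bar{G})\}\ge \lfloor n/2\rfloor-2$ and $\max\{\Delta(G),\Delta(\bar{G})\}\le \lceil n/2\rceil+1$.
   Context: A dominating set in a graph $G$ is a set $S$ of vertices such that every vertex of $G$ is either in $S$ or adjacent to a vertex of $S$. $\partial(G)$ denotes the number of dominating sets of $G$, and $\bar{G}$ denotes the complement of $G$. $\delta(\cdot)$ and $\Delta(\cdot)$ denote minimum and maximum degree. Graphs are finite and simple. *)

(* Defs.v *)
From mathcomp Require Import all_boot.

Set Implicit Arguments.
Unset Strict Implicit.
Unset Printing Implicit Defensive.

Record sgraph := SGraph {
  svertex :> finType;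
  sedge : rel svertex;
  sedge_sym : symmetric sedge;
  sedge_irr : irreflexive sedge }.

Section Graphs.

Variable G : sgraph.
Implicit Types (v : G) (S : {set G}).

Definition compl_rel : rel G := [rel x y | (x != y) && ~~ sedge x y].

Lemma compl_rel_sym : symmetric compl_rel.
Proof. by move=> x y; rewrite /compl_rel /= eq_sym sedge_sym. Qed.

Lemma compl_rel_irr : irreflexive compl_rel.
Proof. by move=> x; rewrite /compl_rel /= eqxx. Qed.

Definition compl : sgraph := SGraph compl_rel_sym compl_rel_irr.

Definition dominating S : bool :=
  [forall v, (v \in S) || [exists u in S, sedge v u]].

Definition num_dom : nat := #|[set S : {set G} | dominating S]|.

Definition deg v : nat := #|[set u | sedge v u]|.

(* Every degree is less than #|G|, so the default value #|G| does not affect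
   the minimum when G has a vertex. *)
Definition min_deg : nat := \big[minn/#|G|]_(v : G) deg v.

Definition max_deg : nat := \max_(v : G) deg v.

End Graphs.

(* Competitors range over all graphs of order n, on any vertex type. *)
Definition dom_sum_maximizer (n : nat) (G : sgraph) : Prop :=
  #|G| = n /\
  forall H : sgraph, #|H| = n ->
    num_dom H + num_dom (compl H) <= num_dom G + num_dom (compl G).

(* Main.v *)
Require Import Defs.
From mathcomp Require Import all_boot.
From mathcomp Require Import zify.

(** A set fails to dominate [G] iff it lies in the [compl G]-neighbourhood of
    some vertex.  Hence a vertex of degree [d] in [compl G] forces at least
    [2 ^ d] non-dominating sets in [G], and vice versa.  On the other hand, for
    the complete bipartite graph with parts [A], [B] and for its complement,
    every non-dominating set lies in [A] or in [B], so the two graphs together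
    have at most [2 * (2 ^ #|A| + 2 ^ #|B| - 1)] of them.  For balanced parts
    this is less than [2 ^ (uphalf n + 2)], so no vertex of a maximizer or of
    its complement has degree [uphalf n + 2] or more; the lower bound on the
    degrees follows by complementation. *)

Lemma compl_edge {G : sgraph} (u v : G) :
  sedge (s := compl G) u v = (u != v) && ~~ sedge u v.
Proof. by []. Qed.

Lemma dominatingPn {G : sgraph} {S : {set G}} :
  reflect (exists v, S \subset [set u | sedge (s := compl G) v u])
          (~~ dominating S).
Proof.
apply: (iffP forallPn) => -[v].
  rewrite negb_or => /andP[vS /exists_inPn vN]; exists v.
  apply/subsetP => u uS; rewrite inE compl_edge (vN u uS) andbT.
  by apply: contraNneq vS => ->.
move=> /subsetP sSv; exists v; rewrite negb_or; apply/andP; split.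
  by apply/negP => /sSv; rewrite inE compl_edge eqxx.
by apply/exists_inPn => u /sSv; rewrite inE compl_edge => /andP[].
Qed.

Lemma num_domC (G : sgraph) :
  num_dom G + #|[set S : {set G} | ~~ dominating S]| = 2 ^ #|G|.
Proof.
rewrite -cardsT -card_powerset powersetT cardsT.
rewrite -(cardsC [set S : {set G} | dominating S]) /num_dom.
by congr (_ + #|pred_of_set _|); apply/setP => S; rewrite !inE.
Qed.

Lemma num_dom_deg_compl {G : sgraph} (v : G) :
  num_dom G + 2 ^ deg (G := compl G) v <= 2 ^ #|G|.
Proof.
rewrite -num_domC leq_add2l -card_powerset subset_leq_card //.
apply/subsetP => S; rewrite powersetE inE => sSv.
by apply/dominatingPn; exists v.
Qed.

Lemma deg_compl_compl {G : sgraph} (v : G) :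
  deg (G := compl (compl G)) v = deg v.
Proof.
apply: eq_card => u; rewrite !inE !compl_edge negb_and !negbK.
by case: eqVneq => // ->; rewrite sedge_irr.
Qed.

Lemma num_dom_compl_deg {G : sgraph} (v : G) :
  num_dom (compl G) + 2 ^ deg v <= 2 ^ #|G|.
Proof. by rewrite -deg_compl_compl (num_dom_deg_compl (G := compl G)). Qed.

Lemma deg_compl {G : sgraph} (v : G) :
  deg v + deg (G := compl G) v = #|G|.-1.
Proof.
(* The neighbourhoods of [v] in [G] and in [compl G] are disjoint and together cover every vertex
   except [v]. *)
rewrite -(cardC1 v) -cardsUI [X in _ + X](_ : _ = 0).
  rewrite addn0; apply: eq_card => u; rewrite !inE compl_edge (eq_sym v).
  by case: eqVneq => [->|_]; rewrite ?sedge_irr //= orbN.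
by apply/eqP; rewrite cards_eq0; apply/eqP/setP => u; rewrite !inE compl_edge;
  case: (sedge v u); rewrite ?andbF.
Qed.

Section CompleteBipartite.

Variables (T : finType) (A : {set T}).

Definition bip_rel : rel T := [rel x y | (x \in A) != (y \in A)].

Lemma bip_rel_sym : symmetric bip_rel.
Proof. by move=> x y; rewrite /bip_rel /= eq_sym. Qed.

Lemma bip_rel_irr : irreflexive bip_rel.
Proof. by move=> x; rewrite /bip_rel /= eqxx. Qed.

Definition bip : sgraph := SGraph bip_rel_sym bip_rel_irr.

Lemma card_sub_part : #|powerset A :|: powerset (~: A)| < 2 ^ #|A| + 2 ^ #|~: A|.
Proof.
rewrite -!card_powerset -cardsUI -[X in X < _]addn0 ltn_add2l card_gt0.
by apply/set0Pn; exists set0; rewrite inE !powersetE !sub0set.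
Qed.

(** Kept general in the edge relation so as to serve both [bip] and its complement. *)
Lemma num_dom_part {e : rel T} {e_sym : symmetric e} {e_irr : irreflexive e}
    (H := SGraph e_sym e_irr) :
    (forall S : {set H}, ~~ dominating S -> (S \subset A) || (S \subset ~: A)) ->
  2 ^ #|T| < num_dom H + (2 ^ #|A| + 2 ^ #|~: A|).
Proof.
move=> subP; rewrite -(num_domC H) ltn_add2l.
apply: leq_ltn_trans card_sub_part; apply: subset_leq_card.
by apply/subsetP => S; rewrite !inE => /subP.
Qed.

Lemma num_dom_bip : 2 ^ #|T| < num_dom bip + (2 ^ #|A| + 2 ^ #|~: A|).
Proof.
apply: num_dom_part => S /dominatingPn[v /subsetP sSv].
case vA: (v \in A); apply/orP; [left|right]; apply/subsetP => u /sSv;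
  by rewrite !inE compl_edge /= /bip_rel /= vA negbK => /andP[_ /eqP <-].
Qed.

Lemma num_dom_compl_bip :
  2 ^ #|T| < num_dom (compl bip) + (2 ^ #|A| + 2 ^ #|~: A|).
Proof.
apply: num_dom_part => S /dominatingPn[v /subsetP sSv].
(* The double complement is [bip] again, so the neighbours of [v] lie on the side opposite to
   [v]. *)
case vA: (v \in A); apply/orP; [right|left]; apply/subsetP => u /sSv;
  rewrite !inE !compl_edge /= /bip_rel /= vA negb_and !negbK => /andP[/negPf -> /=];
  by case: (u \in A).
Qed.

End CompleteBipartite.

Lemma exists_set_card {T : finType} {k} : k <= #|T| -> exists A : {set T}, #|A| = k.
Proof.
case/card_geqP => s [s_uniq <- _]; exists [set x in s].
by rewrite cardsE; apply/card_uniqP.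
Qed.

Lemma maximizer_num_dom {n : nat} {G : sgraph} : dom_sum_maximizer n G ->
  2 ^ n + 2 ^ n < num_dom G + num_dom (compl G) + 2 ^ (uphalf n + 2).
Proof.
case=> cardG maxG.
have [A cardA] : exists A : {set G}, #|A| = uphalf n.
  by apply: exists_set_card; rewrite cardG; lia.
have := maxG (bip G A) cardG; have := num_dom_bip _ A; have := num_dom_compl_bip _ A.
have : #|~: A| <= uphalf n by have := cardsC A; rewrite cardA cardG; lia.
(* Two graphs with two parts each give four powers, each at most [2 ^ uphalf n]; hence the [+ 2] in
   the exponent. *)
rewrite -(leq_exp2l _ _ (isT : 1 < 2)) cardA cardG expnD; lia.
Qed.

Lemma maximizer_deg {n : nat} {G : sgraph} (v : G) : dom_sum_maximizer n G ->
  deg v <= uphalf n + 1 /\ deg (G := compl G) v <= uphalf n + 1.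
Proof.
move=> maxG; have [cardG _] := maxG.
have := maximizer_num_dom maxG.
have := num_dom_deg_compl v; have := num_dom_compl_deg v; rewrite cardG => le1 le2 lt.
(* Adding [le1] and [le2] and comparing with [lt] bounds the sum of the two degree powers strictly
   by [2 ^ (uphalf n + 2)]. *)
have small d : 2 ^ d < 2 ^ (uphalf n + 2) -> d <= uphalf n + 1.
  by rewrite ltn_exp2l //; lia.
have : 0 < 2 ^ deg v by rewrite expn_gt0.
have : 0 < 2 ^ deg (G := compl G) v by rewrite expn_gt0.
by split; apply: small; lia.
Qed.

Theorem theorem2 (n : nat) (G : sgraph) (hn : 1 <= n)
    (hG : dom_sum_maximizer n G) :
  n./2 - 2 <= minn (min_deg G) (min_deg (compl G)) /\
  maxn (max_deg G) (max_deg (compl G)) <= uphalf n + 1.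
Proof.
have [cardG _] := hG.
have degP (v : G) := maximizer_deg v hG.
have le_min (H : sgraph) : #|H| = n -> (forall v : H, n./2 - 2 <= deg v) ->
    n./2 - 2 <= min_deg H.
  move=> cardH le_deg; rewrite /min_deg cardH.
  (* The default value of the minimum is now [n], which also meets the bound. *)
  elim/big_ind: _ => // [|x y lex ley]; first by lia.
  by rewrite leq_min lex.
split.
  (* Since [uphalf n + n./2 = n], subtracting [uphalf n + 1] from [n - 1] leaves [n./2 - 2]. *)
  rewrite leq_min; apply/andP; split; apply: le_min => // v;
    by have := deg_compl (G := G) v; have [] := degP v; rewrite cardG; lia.
by rewrite geq_max; apply/andP; split; apply/bigmax_leqP => v _; case: (degP v).
Qed.
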